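(* There exists an open set $\Omega\subseteq\mathbb R^2$ such that the space $\mathcal D_2(\Omega)$ (relative to the Euclidean distance on $\mathbb R^2$) is non-empty and is not compact.
   Context: Length: for a metric space $(E,\rho)$ and a continuous curve $\gamma\colon[a,b]\to E$, $L_\rho(\gamma):=\sup\{\sum_{i=1}^k\rho(\gamma_{t_i},\gamma_{t_{i-1}}) : k\in\mathbb N,\ a=t_0<t_1<\dots<t_k=b\}\in[0,+\infty]$. $(E,\rho)$ is a length space if $\rho(x,y)=\inf\{L_\rho(\gamma) : \gamma\colon[0,1]\to E \text{ Lipschitz},\ \gamma_0=x,\ \gamma_1=y\}$ for all $x,y\in E$. For $\Omega\subseteq\mathbb R^2$ open, $\mathcal D_2(\Omega)$ is the set of all distances $d$ on $\Omega$ such that $(\Omega,d)$ is a length space and $\frac12|x-y|\le d(x,y)\le2|x-y|$ for all $x,y\in\Omega$. It is endowed with the topology of uniform convergence on compact subsets of $\Omega\times\Omega$. *)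

(* Defs.v *)
From mathcomp Require Import all_boot all_order all_algebra.
From mathcomp Require Import all_classical all_reals all_analysis.

Set Implicit Arguments.
Unset Strict Implicit.
Unset Printing Implicit Defensive.

Import Order.TTheory GRing.Theory Num.Theory.
Import numFieldNormedType.Exports.

Local Open Scope classical_set_scope.
Local Open Scope ring_scope.

(* The library norm on 'rV[R]_2 is the sup norm; it induces the usual topology
   of the plane, but not the Euclidean distance. *)
Definition euclidean_dist (R : realType) (n : nat) (x y : 'rV[R]_n) : R :=
  Num.sqrt (\sum_(i < n) (x ord0 i - y ord0 i) ^+ 2).

Definition is_distance (R : realType) (E : Type) (rho : E -> E -> R) : Prop :=
  [/\ forall x y, 0 <= rho x y,
      forall x y, rho x y = 0 <-> x = y,
      forall x y, rho x y = rho y x &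
      forall x y z, rho x z <= rho x y + rho y z].

(* A curve [a, b] -> E is represented by a map R -> E of which only the values
   on [a, b] are used. *)
Definition curve_length (R : realType) (E : Type) (rho : E -> E -> R)
    (a b : R) (gamma : R -> E) : \bar R :=
  ereal_sup
    [set (let t := nth b (a :: s) in
          \sum_(0 <= i < size s) rho (gamma (t i.+1)) (gamma (t i)))%:E
    | s in itv_partition a b].

Definition lipschitz_curve (R : realType) (E : Type) (rho : E -> E -> R)
    (a b : R) (gamma : R -> E) : Prop :=
  exists K : R, forall s t, s \in `[a, b] -> t \in `[a, b] ->
    rho (gamma s) (gamma t) <= K * `|s - t|.

Definition length_space (R : realType) (E : Type) (rho : E -> E -> R) : Prop :=
  is_distance rho /\
  forall x y, (rho x y)%:E =
    ereal_inf [set curve_length rho 0 1 gamma | gamma in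
      [set gamma : R -> E |
        [/\ lipschitz_curve rho 0 1 gamma, gamma 0 = x & gamma 1 = y]]].

(* The ambient type carries the topology of uniform convergence on the compact
   subsets of Omega * Omega, where Omega, coerced to a type, has the topology
   induced by the plane. *)
Definition D2 (R : realType) (Omega : set 'rV[R]_2) :
    set {family compact, (Omega * Omega)%type -> R} :=
  [set d | length_space (fun x y : Omega => d (x, y)) /\
    forall x y : Omega,
      2^-1 * euclidean_dist (set_val x) (set_val y) <= d (x, y)
        <= 2 * euclidean_dist (set_val x) (set_val y)].
Arguments D2 {R} Omega.

(* Main.v *)
Require Import Defs.
From mathcomp Require Import all_boot all_order all_algebra.
From mathcomp Require Import all_classical all_reals all_analysis.
From mathcomp Require Import lra.

Set Implicit Arguments.
Unset Strict Implicit.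
Unset Printing Implicit Defensive.

Import Order.TTheory GRing.Theory Num.Theory.
Import numFieldNormedType.Exports.
Local Open Scope classical_set_scope.
Local Open Scope ring_scope.

(** The witness is the open upper half plane. For a height [h], let the
distance [highway_dist h] be the cost of the cheapest trip when all moves are
parallel to the axes and cost 1 per unit of length, except along the
horizontal line of height [h], a highway where they cost 1/2:

  highway_dist h p q = min(|x_p - x_q| + |y_p - y_q|,
                           |y_p - h| + |y_q - h| + |x_p - x_q| / 2).

All these distances lie between one half of the taxicab distance and the
taxicab distance, which itself lies between the Euclidean distance and twice
it; so they satisfy the required bounds ([highway_dist_bounds]). When [h > 0] the highway lies inside the half plane,
so each of the two trips above is an actual curve, and the distance is a length
distance ([highway_length_space]).

As [h] decreases to 0, these distances converge pointwise to [highway_dist 0]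
([highway_dist_cvg0]), whose highway has escaped to the boundary. A Lipschitz
curve in the half plane stays above some positive height, where using the
highway never pays off for two points close to each other. Its
[highway_dist 0]-length is therefore at least the taxicab distance of its
endpoints ([highway_dist0_curve_length]). For the points (0, 1) and (8, 1) that
is 8, whereas [highway_dist 0] is 6, so that the limit is not a length distance
([highway_dist0_not_length_space]).

If the space were compact, the family would have a cluster point in it as [h]
decreases to 0. Evaluation at a pair of points is continuous for uniform
convergence on compact sets, so this cluster point could only be the pointwise
limit [highway_dist 0]: a contradiction. *)

(** * Lengths of curves *)

Lemma curve_length_le_lipschitz (R : realType) (E : Type) (rho : E -> E -> R)
    (a b K : R) (gamma : R -> E) :
  (forall s t, s \in `[a, b] -> t \in `[a, b] ->
     rho (gamma s) (gamma t) <= K * `|s - t|) ->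
  (curve_length rho a b gamma <= (K * (b - a))%:E)%E.
Proof.
move=> gammaK; apply: ge_ereal_sup => _ [s sab <-] /=.
set t := nth b (a :: s).
have tab i : (i <= size s)%N -> t i \in `[a, b].
  move=> les; rewrite in_itv /=; apply/andP; split.
    by apply: itv_partition_nth_ge sab; rewrite ltnS.
  by apply: itv_partition_nth_le sab; rewrite ltnS.
have tlt i : (i < size s)%N -> t i <= t i.+1.
  by apply: (@nondecreasing_fun_itv_partition _ _ a b id) => // x y.
rewrite lee_fin.
have -> : K * (b - a) = \sum_(0 <= i < size s) K * (t i.+1 - t i).
  by rewrite -mulr_sumr telescope_sumr // /t (itv_partition_nth_size _ sab).
rewrite big_nat_cond [leRHS]big_nat_cond.
apply: ler_sum => i /andP[/andP[_ lts] _].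
rewrite -[leRHS](_ : K * `|t i.+1 - t i| = _); last first.
  by rewrite ger0_norm // subr_ge0 tlt.
by apply: gammaK; [exact: (tab i.+1)|apply: tab; exact: ltnW].
Qed.

Lemma dist_le_curve_length (R : realType) (E : Type) (rho : E -> E -> R)
    (a b : R) (gamma : R -> E) :
  a < b -> ((rho (gamma b) (gamma a))%:E <= curve_length rho a b gamma)%E.
Proof.
move=> ab; apply: ereal_sup_ubound; exists [:: b]; first exact: itv_partition1.
by rewrite /= big_nat1.
Qed.

(** Curves of speed at most 1, on an interval as long as the cost [l] of the
trip: unlike curves on [0, 1], these can be concatenated without
reparametrization. *)
Definition joined_at_unit_speed (R : realType) (E : Type) (rho : E -> E -> R)
    (l : R) (x y : E) : Prop :=
  0 <= l /\ exists gamma : R -> E,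
    [/\ gamma 0 = x, gamma l = y &
        forall s t, 0 <= s -> s <= t -> t <= l ->
          rho (gamma s) (gamma t) <= t - s].

Lemma joined_at_unit_speed_trans (R : realType) (E : Type) (rho : E -> E -> R)
    (l m : R) (x y z : E) : is_distance rho ->
  joined_at_unit_speed rho l x y -> joined_at_unit_speed rho m y z ->
  joined_at_unit_speed rho (l + m) x z.
Proof.
move=> [_ _ _ rhoD] [l0 [f [f0 fl f1]]] [m0 [g [g0 gm g1]]].
split; first exact: addr_ge0.
exists (fun t => if t <= l then f t else g (t - l)); split=> //.
- by rewrite l0.
- case: ifPn => [|_]; last by rewrite addrAC subrr add0r.
  rewrite gerDl => mle0; have m_eq0 : m = 0 by apply/eqP; rewrite eq_le mle0.
  by move: gm; rewrite m_eq0 addr0 fl g0.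
- move=> s t s0 st tlm; case: (leP s l) => sl; case: (leP t l) => tl.
  + exact: f1.
  + have fle : rho (f s) y <= l - s by rewrite -fl; exact: f1.
    have gle : rho y (g (t - l)) <= t - l.
      by rewrite -g0 -[leRHS]subr0; apply: g1; lra.
    by apply: le_trans (rhoD _ y _) _; lra.
  + lra.
  + by apply: le_trans (g1 _ _ _ _ _) _; lra.
Qed.

Lemma joined_at_unit_speed_line (R : realType) (E : Type) (rho : E -> E -> R)
    (c a b : R) (f : R -> E) : 0 < c ->
  (forall u v, Num.min a b <= u -> Num.min a b <= v ->
     rho (f u) (f v) <= c * `|u - v|) ->
  joined_at_unit_speed rho (c * `|a - b|) (f a) (f b).
Proof.
move=> c0 fc; split; first by rewrite mulr_ge0 // ltW.
(* Travelling from [a] towards [b], in either direction, at speed [c^-1]. *)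
exists (fun t => f (a + Num.sg (b - a) * (c^-1 * t))); split.
- by rewrite !mulr0 addr0.
- by rewrite mulKf ?gt_eqF // distrC -numEsg addrC subrK.
move=> s t s0 st tl.
have cs0 : 0 <= c^-1 * s by rewrite mulr_ge0 // invr_ge0 ltW.
have cst : c^-1 * s <= c^-1 * t by rewrite ler_pM2l ?invr_gt0.
have ctl : c^-1 * t <= `|a - b| by rewrite ler_pdivrMl.
have between u : 0 <= u -> u <= `|a - b| ->
    Num.min a b <= a + Num.sg (b - a) * u.
  rewrite ge_min => u0; case: (ltrgtP a b) => [ab|ba|->] ul; apply/orP.
  - by left; rewrite gtr0_sg ?subr_gt0 //; lra.
  - right; rewrite ltr0_sg ?subr_lt0 //; lra.
  - by left; rewrite subrr sgr0 mul0r addr0.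
apply: le_trans (fc _ _ _ _) _.
- by apply: between => //; lra.
- by apply: between => //; lra.
rewrite opprD addrACA subrr add0r -mulrBr normrM -mulrBr normrM.
rewrite (gtr0_norm (x := c^-1)) ?invr_gt0 // distrC.
rewrite (ger0_norm (x := t - s)) ?subr_ge0 // mulrCA mulVKf ?gt_eqF //.
by rewrite ler_piMl ?subr_ge0 // normr_sg; case: (_ != _).
Qed.

(** A distance never exceeds the length of a curve, so only the existence of
curves that are no longer than the distance is at stake; rescaling a unit speed
curve to [0, 1] gives one. *)
Lemma length_space_unit_speed (R : realType) (E : Type) (rho : E -> E -> R) :
  is_distance rho -> (forall x y, joined_at_unit_speed rho (rho x y) x y) ->
  length_space rho.
Proof.
move=> drho joined; split=> // x y; apply/eqP; rewrite eq_le; apply/andP.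
have [_ _ rhoC _] := drho; split.
  apply: le_ereal_inf_tmp => _ [gamma [_ <- <-] <-].
  by rewrite rhoC; apply: dist_le_curve_length.
have [l0 [f [f0 fl f1]]] := joined x y.
have lip s t : s \in `[0, 1] -> t \in `[0, 1] ->
    rho (f (rho x y * s)) (f (rho x y * t)) <= rho x y * `|s - t|.
  wlog st : s t / s <= t => [wst|].
    have [/wst//|/ltW/wst ts sI tI] := leP s t.
    by rewrite rhoC distrC; apply: ts.
  rewrite !in_itv /= => /andP[s0 s1] /andP[t0 t1].
  rewrite distrC ger0_norm ?subr_ge0 // mulrBr; apply: f1.
  - exact: mulr_ge0.
  - exact: ler_wpM2l.
  - exact: ler_piMr.
apply: (@le_trans _ _ (curve_length rho 0 1 (fun t => f (rho x y * t)))).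
  apply: ereal_inf_lbound; exists (fun t => f (rho x y * t)) => //.
  by split; [exists (rho x y)|rewrite mulr0|rewrite mulr1].
by have := curve_length_le_lipschitz lip; rewrite subr0 mulr1.
Qed.

(** Length only depends on the distance between nearby points, so a local
comparison of [sigma] with [rho] suffices: on a subdivision of mesh at most
[delta], the triangle inequality for [sigma] gives the bound. *)
Lemma curve_length_ge_local (R : realType) (E : Type) (rho sigma : E -> E -> R)
    (gamma : R -> E) (delta : R) :
  is_distance sigma -> 0 < delta ->
  (forall s t, s \in `[0, 1] -> t \in `[0, 1] -> `|s - t| <= delta ->
     sigma (gamma s) (gamma t) <= rho (gamma s) (gamma t)) ->
  ((sigma (gamma 0) (gamma 1))%:E <= curve_length rho 0 1 gamma)%E.
Proof.
move=> [_ sigma0 sigmaC sigmaD] delta0 loc.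
have [N Nlarge] : exists N : nat, delta^-1 <= N.+1%:R.
  exists (Num.truncn delta^-1); apply: ltW; exact: truncnS_gt.
have N0 : (0 : R) < N.+1%:R by rewrite ltr0n.
pose t (i : nat) : R := i%:R / N.+1%:R.
pose s := [seq t i.+1 | i <- iota 0 N.+1].
have nths i : (i <= N.+1)%N -> nth 1 (0 :: s) i = t i.
  case: i => [|i] iN /=; first by rewrite /t mul0r.
  by rewrite (nth_map 0%N) ?size_iota // nth_iota.
have sizes : size s = N.+1 by rewrite size_map size_iota.
have tN : t N.+1 = 1 by rewrite /t divff // gt_eqF.
have tI i : (i <= N.+1)%N -> t i \in `[0, 1].
  move=> iN; rewrite in_itv /= divr_ge0 //=.
  by rewrite ler_pdivrMr // mul1r ler_nat.
have part : itv_partition 0 1 s.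
  split; last first.
    by rewrite (last_nth 1) sizes nths // tN.
  apply/(pathP 1) => i; rewrite sizes => iN.
  have := nths i.+1 iN; rewrite /= => ->.
  rewrite nths ?(ltnW iN) // /t ltr_pM2r ?invr_gt0 //.
  by rewrite ltr_nat.
apply: (@le_trans _ _ (\sum_(0 <= i < size s)
    rho (gamma (nth 1 (0 :: s) i.+1)) (gamma (nth 1 (0 :: s) i)))%:E);
  last first.
  by apply: ereal_sup_ubound; exists s.
rewrite lee_fin sizes.
have chain n : (n <= N.+1)%N -> sigma (gamma (t 0%N)) (gamma (t n)) <=
    \sum_(0 <= i < n)
      rho (gamma (nth 1 (0 :: s) i.+1)) (gamma (nth 1 (0 :: s) i)).
  elim: n => [_|n IH nN].
    by rewrite big_geq // (proj2 (sigma0 _ _)).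
  rewrite big_nat_recr //=; apply: le_trans (sigmaD _ (gamma (t n)) _) _.
  apply: lerD; first by apply: IH; apply: ltnW.
  have := nths n.+1 nN; rewrite /= => ->; rewrite nths ?(ltnW nN) // sigmaC.
  apply: loc; rewrite ?tI ?(ltnW nN) //.
  rewrite /t -mulrBl -natrB // subSnn div1r ger0_norm ?invr_ge0 ?ler0n //.
  by rewrite -[leRHS]invrK lef_pV2 ?posrE ?invr_gt0.
by have := chain N.+1 (leqnn _); rewrite tN {1}/t mul0r.
Qed.

(** A continuous function attains its minimum on [a, b]. *)
Lemma lipschitz_positive_lower_bound (R : realType) (f : R -> R) (a b K : R) :
  a <= b ->
  (forall s t, s \in `[a, b] -> t \in `[a, b] ->
     `|f s - f t| <= K * `|s - t|) ->
  (forall t, t \in `[a, b] -> 0 < f t) ->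
  exists2 m, 0 < m & forall t, t \in `[a, b] -> m <= f t.
Proof.
move=> ab fK f0; suff /(EVT_min ab)[c cab fc] : {within `[a, b], continuous f}.
  by exists (f c) => //; exact: f0.
apply/subspace_continuousP => x xab; apply/cvgrPdist_le => /= e e0.
(* The constant [K] may be negative or zero; [`|K| + 1] can be divided by. *)
have K0 : 0 < `|K| + 1 by rewrite ltr_wpDl.
near=> t; have tab : t \in `[a, b] by near: t; exact: withinT.
apply: le_trans (fK _ _ xab tab) _.
apply: (@le_trans _ _ ((`|K| + 1) * `|x - t|)).
  by apply: ler_wpM2r => //; rewrite (le_trans (ler_norm _)) // lerDl.
rewrite -ler_pdivlMl //; near: t; apply: cvg_within.
have ce0 : (`|K| + 1)^-1 * e > 0 by rewrite mulr_gt0 ?invr_gt0.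
exact: (@cvgr_dist_le _ _ _ _ _ id x cvg_id _ ce0).
Unshelve. all: by end_near. Qed.

(** * The upper half plane *)

Definition half_plane (R : realType) : set 'rV[R]_2 :=
  [set v | 0 < v ord0 ord_max].
Arguments half_plane : clear implicits.

Definition xcoord (R : realType) (p : half_plane R) : R :=
  set_val p ord0 ord0.

Definition ycoord (R : realType) (p : half_plane R) : R :=
  set_val p ord0 ord_max.

Lemma ycoord_gt0 (R : realType) (p : half_plane R) : 0 < ycoord p.
Proof. exact: (set_valP p). Qed.

Definition plane_point (R : realType) (x y : R) : 'rV[R]_2 :=
  \row_(j < 2) if j == ord0 then x else y.

Lemma half_plane_clip (R : realType) (x y : R) :
  plane_point x (if 0 < y then y else 1) \in half_plane R.
Proof.
apply/mem_set; rewrite /half_plane /= mxE /=.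
by case: ifP => // _; exact: ltr01.
Qed.

(** Curves are functions on the whole real line, so points have to be built from
arbitrary coordinates: a height that is not positive is replaced by 1. *)
Definition hpoint (R : realType) (x y : R) : half_plane R :=
  SigSub (half_plane_clip x y).

Lemma xcoord_hpoint (R : realType) (x y : R) : xcoord (hpoint x y) = x.
Proof. by rewrite /xcoord /= mxE. Qed.

Lemma ycoord_hpoint (R : realType) (x y : R) : 0 < y ->
  ycoord (hpoint x y) = y.
Proof. by move=> y0; rewrite /ycoord /= mxE /= y0. Qed.

Lemma half_plane_eq (R : realType) (p q : half_plane R) :
  xcoord p = xcoord q -> ycoord p = ycoord q -> p = q.
Proof.
move=> xpq ypq; apply/val_inj/rowP => j.
have : j = ord0 \/ j = ord_max.
  by case: j => [[|[|//]]] ?; [left|right]; apply: val_inj.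
by case=> ->.
Qed.

Lemma hpointK (R : realType) (p : half_plane R) :
  hpoint (xcoord p) (ycoord p) = p.
Proof.
apply: half_plane_eq; first exact: xcoord_hpoint.
by apply: ycoord_hpoint; apply: ycoord_gt0.
Qed.

Lemma open_half_plane (R : realType) : open (half_plane R).
Proof.
rewrite (_ : half_plane R =
  (fun v : 'rV[R]_2 => v ord0 ord_max) @^-1` [set t | 0 < t]) //.
by apply: open_comp => [v _|]; [exact: coord_continuous|exact: open_gt].
Qed.

(** * Highway distances *)

Definition taxicab (R : realType) (p q : half_plane R) : R :=
  `|xcoord p - xcoord q| + `|ycoord p - ycoord q|.

Definition highway_trip (R : realType) (h : R) (p q : half_plane R) : R :=
  `|ycoord p - h| + `|ycoord q - h| + `|xcoord p - xcoord q| / 2.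

Definition highway_dist (R : realType) (h : R) (p q : half_plane R) : R :=
  Num.min (taxicab p q) (highway_trip h p q).

Lemma highway_dist_le_taxicab (R : realType) (h : R) (p q : half_plane R) :
  highway_dist h p q <= taxicab p q.
Proof. by rewrite ge_min lexx. Qed.

(** The highway only halves the horizontal part of a trip: the vertical part of
a highway trip is at least the difference of heights. *)
Lemma taxicab_le_highway_dist (R : realType) (h : R) (p q : half_plane R) :
  taxicab p q <= 2 * highway_dist h p q.
Proof.
have t0 : 0 <= taxicab p q by apply: addr_ge0.
rewrite /highway_dist.
case: (leP (taxicab p q) (highway_trip h p q)) => _; first by lra.
have := ler_distD h (ycoord p) (ycoord q); rewrite (distrC h).
rewrite /taxicab /highway_trip; have := normr_ge0 (ycoord p - ycoord q); lra.
Qed.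

Lemma taxicab_distance (R : realType) : is_distance (@taxicab R).
Proof.
split=> [p q|p q|p q|p q r]; rewrite /taxicab.
- exact: addr_ge0.
- split=> [/eqP|->]; last by rewrite !subrr normr0 addr0.
  rewrite paddr_eq0 // !normr_eq0 !subr_eq0 => /andP[/eqP xpq /eqP ypq].
  exact: half_plane_eq.
- by rewrite distrC (distrC (ycoord p)).
- have := ler_distD (xcoord q) (xcoord p) (xcoord r).
  have := ler_distD (ycoord q) (ycoord p) (ycoord r); lra.
Qed.

Lemma highway_dist_distance (R : realType) (h : R) :
  is_distance (@highway_dist R h).
Proof.
have [taxi_ge0 taxi_eq0 taxiC taxiD] := taxicab_distance R.
split=> [p q|p q|p q|p q r].
- have := taxicab_le_highway_dist h p q; have := taxi_ge0 p q; lra.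
- split=> [d0|->].
    apply/taxi_eq0/eqP; rewrite eq_le taxi_ge0 andbT.
    by have := taxicab_le_highway_dist h p q; rewrite d0 mulr0.
  apply/eqP; rewrite eq_le; apply/andP; split.
    by rewrite -[leRHS](proj2 (taxi_eq0 q q)) // highway_dist_le_taxicab.
  have := taxicab_le_highway_dist h q q.
  by rewrite (proj2 (taxi_eq0 _ _)) //; lra.
- rewrite /highway_dist taxiC; congr Num.min.
  by rewrite /highway_trip (distrC (xcoord p)) [`|ycoord p - h| + _]addrC.
- have dx := ler_distD (xcoord q) (xcoord p) (xcoord r).
  have := ler_distD (ycoord q) (ycoord p) h.
  have := ler_distD (ycoord q) (ycoord r) h.
  have := normr_ge0 (ycoord q - h).
  have := normr_ge0 (xcoord p - xcoord q).
  have := normr_ge0 (xcoord q - xcoord r).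
  have := taxiD p q r.
  rewrite /highway_dist ge_min.
  case: (leP (taxicab p q) (highway_trip h p q)) => _;
    case: (leP (taxicab q r) (highway_trip h q r)) => _;
    rewrite /taxicab /highway_trip (distrC (ycoord r) (ycoord q)) => *;
    apply/orP; (left; lra) || (right; lra).
Qed.

Lemma euclidean_distE (R : realType) (p q : half_plane R) :
  euclidean_dist (set_val p) (set_val q) =
  Num.sqrt ((xcoord p - xcoord q) ^+ 2 + (ycoord p - ycoord q) ^+ 2).
Proof.
rewrite /euclidean_dist big_ord_recr big_ord1 /=; congr (Num.sqrt (_ + _)).
by rewrite /xcoord (_ : widen_ord _ _ = ord0) //; apply: val_inj.
Qed.

Lemma euclidean_dist_le_taxicab (R : realType) (p q : half_plane R) :
  euclidean_dist (set_val p) (set_val q) <= taxicab p q.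
Proof.
rewrite euclidean_distE -[leRHS]ger0_norm; last exact: addr_ge0.
rewrite -[leRHS]sqrtr_sqr; apply: ler_wsqrtr.
rewrite /taxicab [leRHS]sqrrD !real_normK ?num_real //.
by rewrite addrAC lerDl mulrn_wge0 // mulr_ge0.
Qed.

Lemma taxicab_le_euclidean_dist (R : realType) (p q : half_plane R) :
  taxicab p q <= 2 * euclidean_dist (set_val p) (set_val q).
Proof.
have coord_le (a b : R) : `|a| <= Num.sqrt (a ^+ 2 + b ^+ 2).
  by rewrite -sqrtr_sqr; apply: ler_wsqrtr; rewrite lerDl sqr_ge0.
rewrite euclidean_distE mulr_natl mulr2n /taxicab; apply: lerD => //.
by rewrite [_ ^+ 2 + _]addrC.
Qed.

Lemma highway_dist_bounds (R : realType) (h : R) (p q : half_plane R) :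
  2^-1 * euclidean_dist (set_val p) (set_val q) <= highway_dist h p q
    <= 2 * euclidean_dist (set_val p) (set_val q).
Proof.
have := euclidean_dist_le_taxicab p q; have := taxicab_le_euclidean_dist p q.
have := highway_dist_le_taxicab h p q; have := taxicab_le_highway_dist h p q.
by move=> *; apply/andP; split; lra.
Qed.

(** The next three lemmas give the pieces that trips are made of: vertical
moves, ordinary horizontal moves, and horizontal moves on the highway. *)
Lemma highway_joined_vertical (R : realType) (h x y z : R) : 0 < y -> 0 < z ->
  joined_at_unit_speed (@highway_dist R h) `|y - z| (hpoint x y) (hpoint x z).
Proof.
move=> y0 z0; rewrite -[`|_|]mul1r.
apply: (joined_at_unit_speed_line (f := hpoint x)) => // u v yzu yzv.
have yz0 : 0 < Num.min y z by rewrite lt_min y0.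
apply: le_trans (highway_dist_le_taxicab _ _ _) _.
rewrite /taxicab !xcoord_hpoint !ycoord_hpoint ?subrr ?normr0 ?add0r ?mul1r //.
  exact: lt_le_trans yzv.
exact: lt_le_trans yzu.
Qed.

Lemma highway_joined_horizontal (R : realType) (h x z y : R) : 0 < y ->
  joined_at_unit_speed (@highway_dist R h) `|x - z| (hpoint x y) (hpoint z y).
Proof.
move=> y0; rewrite -[`|_|]mul1r.
apply: (@joined_at_unit_speed_line _ _ _ _ x z (fun u => hpoint u y)) => //
  u v _ _.
apply: le_trans (highway_dist_le_taxicab _ _ _) _.
by rewrite /taxicab !xcoord_hpoint !ycoord_hpoint // subrr normr0 addr0 mul1r.
Qed.

Lemma highway_joined_fast (R : realType) (h x z : R) : 0 < h ->
  joined_at_unit_speed (@highway_dist R h) (`|x - z| / 2)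
    (hpoint x h) (hpoint z h).
Proof.
move=> h0; rewrite mulrC.
apply: (@joined_at_unit_speed_line _ _ _ _ x z (fun u => hpoint u h)) =>
  [|u v _ _]; first lra.
rewrite /highway_dist ge_min /highway_trip !xcoord_hpoint !ycoord_hpoint //.
by rewrite subrr normr0 !add0r mulrC lexx orbT.
Qed.

(** Both trips in the definition of [highway_dist] are realized by curves: a
horizontal then a vertical move for the taxicab one; a vertical move to the
highway, a ride on it and a vertical move for the other, which requires the
highway to lie in the open half plane. *)
Lemma highway_length_space (R : realType) (h : R) : 0 < h ->
  length_space (@highway_dist R h).
Proof.
move=> h0; have dh := @highway_dist_distance R h.
apply: length_space_unit_speed => // p q.
have p0 := ycoord_gt0 p; have q0 := ycoord_gt0 q.
rewrite -{2}(hpointK p) -{2}(hpointK q) /highway_dist.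
case: (leP (taxicab p q) (highway_trip h p q)) => _.
  apply: (joined_at_unit_speed_trans dh (highway_joined_horizontal _ _ _ p0)).
  exact: highway_joined_vertical.
rewrite /highway_trip addrAC.
apply: (joined_at_unit_speed_trans dh (y := hpoint (xcoord q) h)).
  apply: (joined_at_unit_speed_trans dh (highway_joined_vertical _ _ p0 h0)).
  exact: highway_joined_fast.
by rewrite distrC; apply: highway_joined_vertical.
Qed.

(** * The limit distance is not a length distance *)

(** The curve stays above a height [m > 0]; reaching the boundary and coming
back costs at least [2 * m], so two points of the curve at distance at most [m]
are joined at best by the taxicab trip. *)
Lemma highway_dist0_curve_length (R : realType) (gamma : R -> half_plane R) :
  lipschitz_curve (@highway_dist R 0) 0 1 gamma ->
  ((taxicab (gamma 0) (gamma 1))%:E <=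
     curve_length (@highway_dist R 0) 0 1 gamma)%E.
Proof.
move=> [K gammaK].
have [m m0 my] : exists2 m, 0 < m &
    forall t, t \in `[0, 1] -> m <= ycoord (gamma t).
  apply: (@lipschitz_positive_lower_bound _ _ 0 1 (2 * K)) => //.
    move=> s t sI tI; rewrite -mulrA.
    apply: (@le_trans _ _ (taxicab (gamma s) (gamma t))).
      by rewrite /taxicab lerDr.
    apply: le_trans (taxicab_le_highway_dist 0 _ _) _.
    by rewrite ler_pM2l //; apply: gammaK.
  by move=> t _; exact: ycoord_gt0.
have K0 : 0 < `|K| + 1 by rewrite ltr_wpDl.
apply: (curve_length_ge_local (delta := m / (`|K| + 1))).
- exact: taxicab_distance.
- exact: divr_gt0.
move=> s t sI tI; rewrite ler_pdivlMr // => st.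
have short : highway_dist 0 (gamma s) (gamma t) <= m.
  apply: le_trans (gammaK _ _ sI tI) (le_trans _ st).
  by rewrite mulrC ler_wpM2l // (le_trans (ler_norm _)) // lerDl.
have high : m < highway_trip 0 (gamma s) (gamma t).
  have := my s sI; have := my t tI.
  have := ler_norm (ycoord (gamma s)); have := ler_norm (ycoord (gamma t)).
  have := normr_ge0 (xcoord (gamma s) - xcoord (gamma t)).
  by rewrite /highway_trip !subr0; lra.
rewrite le_min lexx /=; move: short.
rewrite /highway_dist ge_min [X in _ || X]leNgt high orbF => /le_trans; apply.
exact: ltW.
Qed.

(** Between (0, 1) and (8, 1), the highway trip on the boundary costs
1 + 1 + 8 / 2 = 6, and every curve has length at least 8. *)
Lemma highway_dist0_not_length_space (R : realType) :
  ~ length_space (@highway_dist R 0).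
Proof.
move=> [_ /(_ (hpoint 0 1) (hpoint 8 1)) dE].
have : ((taxicab (hpoint 0 1) (hpoint 8 1))%:E <=
    (highway_dist 0 (hpoint 0 1) (hpoint 8 1) : R)%:E)%E.
  rewrite dE; apply: le_ereal_inf_tmp => _ [gamma [gammaK <- <-] <-].
  exact: highway_dist0_curve_length.
rewrite lee_fin /highway_dist /taxicab /highway_trip.
rewrite !xcoord_hpoint !ycoord_hpoint // !subrr !subr0 sub0r normrN normr0.
by rewrite normr1 ger0_norm // le_min => /andP[_]; lra.
Qed.

(** * Failure of compactness *)

Lemma highway_dist_cvg0 (R : realType) (p q : half_plane R) :
  highway_dist h p q @[h --> (0 : R)] --> highway_dist 0 p q.
Proof.
have dist_cvg (r : half_plane R) :
    `|ycoord r - h| @[h --> (0 : R)] --> `|ycoord r - 0|.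
  by apply: cvg_norm; apply: cvgB; [exact: cvg_cst|exact: cvg_id].
apply: (@continuous_min R R (fun=> taxicab p q)
  (fun h => highway_trip h p q) 0); first exact: cvg_cst.
by apply: cvgD; [apply: cvgD; exact: dist_cvg|exact: cvg_cst].
Qed.

Lemma cluster_cvg_eq (T U : topologicalType) (F : set_system T) (f : T -> U)
    (x : T) (l : U) : Filter F -> hausdorff_space U ->
  cluster F x -> {for x, continuous f} -> f @ F --> l -> f x = l.
Proof.
move=> FF hU Fx fx fl; apply/esym/hU => A B /fl FA /fx xB.
by have [y [Ay By]] := Fx _ _ FA xB; exists (f y).
Qed.

(** Singletons are compact, so uniform convergence on compact sets implies
pointwise convergence. *)
Lemma compact_family_eval_continuous (T : topologicalType) (V : uniformType)
    (x : T) :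
  continuous ((fun f => f x) : {family compact, T -> V} -> V).
Proof.
move=> f; have := @cvg_id _ (nbhs f).
move=> /fam_cvgP /(_ [set x] (@compact_set1 T x)).
by rewrite uniform_set1.
Qed.

Theorem corollary4p2 (R : realType) :
  exists Omega : set 'rV[R]_2,
    [/\ open Omega, D2 Omega !=set0 & ~ compact (D2 Omega)].
Proof.
pose d (h : R) : {family compact, (half_plane R * half_plane R)%type -> R} :=
  fun pq => highway_dist h pq.1 pq.2.
have dD2 h : 0 < h -> D2 (half_plane R) (d h).
  move=> h0; split; first exact: highway_length_space.
  by move=> p q; exact: highway_dist_bounds.
exists (half_plane R); split.
- exact: open_half_plane.
- by exists (d 1); apply: dD2.
move=> /(_ (d h @[h --> 0^'+])) [].
  suff : \forall h \near 0^'+, D2 (half_plane R) (d h) by [].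
  by near=> h; apply: dD2; near: h; exact: nbhs_right_gt.
move=> g [[g_length _] g_cluster].
apply: (@highway_dist0_not_length_space R).
suff <- : (fun p q => g (p, q)) = @highway_dist R 0 by [].
apply/funext => p; apply/funext => q.
pose HH : topologicalType := (half_plane R * half_plane R)%type.
pose eval (f : {family compact, HH -> R}) : R := f (p, q).
apply: (@cluster_cvg_eq _ _ _ eval g _ _ (@Rhausdorff R) g_cluster).
  exact: (@compact_family_eval_continuous HH R (p, q)).
exact: (cvg_at_right_filter (@highway_dist_cvg0 R p q)).
Unshelve. all: by end_near. Qed.
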